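(* Let $(X_n)$ be generated by the $\lambda$-SAGA algorithm (defined in the context) with fixed $\lambda\in[0,1]$ and a positive deterministic step sequence $(\gamma_n)$ decreasing to $0$ with $\sum\gamma_n=+\infty$ and $\sum\gamma_n^2<+\infty$. Assume (A1) $f$ is continuously differentiable with a unique $x^*$ such that $\nabla f(x^* )=0$; (A3) there is $L>0$ with $\tau^2(x)\le L\|x-x^*\|^2$ for all $x$; (A5) there is $\mu>0$ with $\langle x-x^*,\nabla f(x)\rangle\ge\mu\|x-x^*\|^2$ for all $x$. Then almost surely $$\sum_{n\ge1}\gamma_nV_n<\infty,\qquad\sum_{n\ge1}\gamma_nA_n<\infty,\qquad\sum_{n\ge1}\gamma_n\tau^2(X_n)<\infty,$$ and moreover $$\sum_{n\ge1}\gamma_n\mathbb E[V_n]<\infty,\qquad\sum_{n\ge1}\gamma_n\mathbb E[A_n]<\infty,\qquad\sum_{n\ge1}\gamma_n\mathbb E[\tau^2(X_n)]<\infty.$$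
   Context: Let $N,d\ge1$ be integers, $f_1,\dots,f_N:\mathbb R^d\to\mathbb R$ differentiable, and $f=\frac1N\sum_{k=1}^N f_k$. The $\lambda$-SAGA algorithm with parameter $\lambda\in[0,1]$ and positive deterministic steps $(\gamma_n)_{n\ge1}$: let $X_0,X_1$ be square-integrable random vectors in $\mathbb R^d$ and $(U_n)_{n\ge2}$ i.i.d. uniform on $\{1,\dots,N\}$, independent of $(X_0,X_1)$. Set $g_{1,k}=\nabla f_k(X_0)$ for $k=1,\dots,N$ and for $n\ge1$: $X_{n+1}=X_n-\gamma_n\Big(\nabla f_{U_{n+1}}(X_n)-\lambda\big(g_{n,U_{n+1}}-\frac1N\sum_{k=1}^N g_{n,k}\big)\Big)$, and $g_{n+1,k}=\nabla f_k(X_n)$ if $U_{n+1}=k$, $g_{n+1,k}=g_{n,k}$ otherwise. Define $\phi_{n,k}$ by $\phi_{1,k}=X_0$, $\phi_{n+1,k}=X_n$ if $U_{n+1}=k$ and $\phi_{n+1,k}=\phi_{n,k}$ otherwise (so $g_{n,k}=\nabla f_k(\phi_{n,k})$). Notation: $V_n=\|X_n-x^*\|^2$, $\tau^2(x)=\frac1N\sum_{k=1}^N\|\nabla f_k(x)-\nabla f_k(x^* )\|^2$, $A_n=\frac1N\sum_{k=1}^N\|\nabla f_k(\phi_{n,k})-\nabla f_k(x^* )\|^2$. *)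

(* Defs.v *)
From HB Require Import structures.
From mathcomp Require Import all_boot all_order all_algebra.
From mathcomp Require Import finmap.
From mathcomp Require Import all_classical all_reals all_analysis.

Set Implicit Arguments.
Unset Strict Implicit.
Unset Printing Implicit Defensive.

Import Order.TTheory GRing.Theory Num.Theory.
Import numFieldNormedType.Exports.

Local Open Scope classical_set_scope.
Local Open Scope ring_scope.

Section SagaDefs.
Variable R : realType.

Definition dotv (d : nat) (u v : 'rV[R]_d) : R := \sum_(i < d) u 0 i * v 0 i.
Definition sqn (d : nat) (u : 'rV[R]_d) : R := dotv u u.

Definition grad (d : nat) (F : 'rV[R]_d -> R) (x : 'rV[R]_d) : 'rV[R]_d :=
  \row_(i < d) ('D_(delta_mx 0 i : 'rV[R]_d) F x).

Definition favg (N d : nat) (fk : 'I_N -> 'rV[R]_d -> R) (x : 'rV[R]_d) : R :=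
  N%:R^-1 * \sum_(k < N) fk k x.

Definition tau2 (N d : nat) (fk : 'I_N -> 'rV[R]_d -> R) (xs x : 'rV[R]_d) : R :=
  N%:R^-1 * \sum_(k < N) sqn (grad (fk k) x - grad (fk k) xs).

(* The memory points phi_{n,k}.  phi' m k w is phi_{m+1,k}(w):
   phi_{1,k} = X_0, phi_{n+1,k} = X_n if U_{n+1} = k, else phi_{n,k}. *)
Fixpoint phi' (T : Type) (N d : nat) (X : nat -> T -> 'rV[R]_d)
    (U : nat -> T -> 'I_N) (m : nat) (k : 'I_N) (w : T) : 'rV[R]_d :=
  match m with
  | 0 => X 0%N w
  | m'.+1 => if U m'.+2 w == k then X m'.+1 w else phi' X U m' k w
  end.

Definition phi (T : Type) (N d : nat) (X : nat -> T -> 'rV[R]_d)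
    (U : nat -> T -> 'I_N) (n : nat) (k : 'I_N) (w : T) : 'rV[R]_d :=
  phi' X U n.-1 k w.

Definition Aseq (T : Type) (N d : nat) (fk : 'I_N -> 'rV[R]_d -> R)
    (xs : 'rV[R]_d) (X : nat -> T -> 'rV[R]_d) (U : nat -> T -> 'I_N)
    (n : nat) (w : T) : R :=
  N%:R^-1 * \sum_(k < N) sqn (grad (fk k) (phi X U n k w) - grad (fk k) xs).

Definition saga_recursion (T : Type) (N d : nat) (fk : 'I_N -> 'rV[R]_d -> R)
    (lam : R) (gam : nat -> R) (X : nat -> T -> 'rV[R]_d)
    (U : nat -> T -> 'I_N) : Prop :=
  forall (n : nat) (w : T), (1 <= n)%N ->
    X n.+1 w = X n w - gam n *:
      (grad (fk (U n.+1 w)) (X n w)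
       - lam *: (grad (fk (U n.+1 w)) (phi X U n (U n.+1 w) w)
                 - N%:R^-1 *: \sum_(k < N) grad (fk k) (phi X U n k w))).

Definition mutually_independent (dT : measure_display) (T : measurableType dT)
    (P : probability T R) (F : nat -> set (set T)) : Prop :=
  forall (J : {fset nat}) (E : nat -> set T),
    (forall i, i \in J -> F i (E i)) ->
    P (\bigcap_(i in [set` J]) E i) = (\prod_(i <- J) P (E i))%E.

Definition sigma_pair (T : Type) (d : nat) (X0 X1 : T -> 'rV[R]_d) : set (set T) :=
  <<s [set E | exists (i : 'I_d) (b : bool) (B : set R),
               measurable B /\
               E = (fun w => (if b then X0 w else X1 w) 0 i) @^-1` B] >>.

Definition sigma_disc (T : Type) (N : nat) (Un : T -> 'I_N) : set (set T) :=
  [set E | exists A : set 'I_N, E = Un @^-1` A].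

Definition saga_family (T : Type) (N d : nat) (X0 X1 : T -> 'rV[R]_d)
    (U : nat -> T -> 'I_N) (i : nat) : set (set T) :=
  match i with
  | 0 => sigma_pair X0 X1
  | 1 => [set set0; setT]
  | n => sigma_disc (U n)
  end.

End SagaDefs.

(* Main.v *)
(**
Averaging one step over the uniform index [U n.+1], which is independent of the
history up to time [n], gives with [V n = sqn (X n - xs)], [A n] the memory error
and [C] the mean of the [sqn (grad (fk k) xs)]:
  E V(n+1) + 2 gam mu E V(n) <= E V(n) + 3 gam^2 (L E V(n) + E A(n) + C),
  E A(n+1) <= (1 - 1/N) E A(n) + (L/N) E V(n).
Hence the Lyapunov function V + (N mu / L) gam A decreases in expectation by
gam (mu/L) (L V + A), up to terms of order gam^2. As soon as gam is small the
quadratic term in V and A is absorbed, and telescoping with sum gam^2 < oo bounds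
sum gam (L E V + E A). The bound on tau2 is [tau2 <= L V], and the almost sure
statements follow because a nonnegative series with finite expectation is finite
almost surely.
*)
Require Import Defs.
From HB Require Import structures.
From mathcomp Require Import all_boot all_order all_algebra.
From mathcomp Require Import finmap.
From mathcomp Require Import all_classical all_reals all_analysis.
From mathcomp Require Import measurable_realfun ring lra.
Import Order.TTheory GRing.Theory Num.Theory.
Import numFieldNormedType.Exports.
Local Open Scope classical_set_scope.
Local Open Scope ring_scope.

(** * Uniform means *)

Section Mean.
Context {R : realFieldType} {N : nat}.

Definition mean (F : 'I_N -> R) : R := N%:R^-1 * \sum_k F k.

Lemma eq_mean (F G : 'I_N -> R) : F =1 G -> mean F = mean G.
Proof. by move=> FG; congr (_ * _); apply: eq_bigr => k _. Qed.

Lemma meanD (F G : 'I_N -> R) : mean (fun k => F k + G k) = mean F + mean G.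
Proof. by rewrite /mean big_split mulrDr. Qed.

Lemma meanZ (c : R) (F : 'I_N -> R) : mean (fun k => c * F k) = c * mean F.
Proof. by rewrite /mean -mulr_sumr mulrCA. Qed.

Lemma mean_sum (I : Type) (s : seq I) (F : I -> 'I_N -> R) :
  mean (fun k => \sum_(i <- s) F i k) = \sum_(i <- s) mean (F i).
Proof. by rewrite /mean exchange_big mulr_sumr. Qed.

Lemma ler_mean (F G : 'I_N -> R) : (forall k, F k <= G k) -> mean F <= mean G.
Proof. by move=> FG; rewrite ler_wpM2l ?invr_ge0// ler_sum. Qed.

Lemma mean_ge0 (F : 'I_N -> R) : (forall k, 0 <= F k) -> 0 <= mean F.
Proof. by move=> F0; rewrite mulr_ge0 ?invr_ge0// sumr_ge0. Qed.

Hypothesis N0 : (0 < N)%N.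

Lemma mean_cst (c : R) : mean (fun=> c) = c.
Proof.
by rewrite /mean sumr_const card_ord -[c *+ N]mulr_natl mulKf// pnatr_eq0 -lt0n.
Qed.

(** Drawing [j] alters only slot [j], so the inner mean moves by [(s j - t j) / N]. This is the
    source of the contraction factor [1 - 1/N] of the memory error. *)
Lemma mean_refresh (s t : 'I_N -> R) :
  mean (fun j => mean (fun k => if j == k then s k else t k)) =
  (1 - N%:R^-1) * mean t + N%:R^-1 * mean s.
Proof.
have N1 : N%:R != 0 :> R by rewrite pnatr_eq0 -lt0n.
transitivity (mean (fun j => mean t + N%:R^-1 * (s j - t j))).
  apply: eq_mean => j; rewrite /mean -mulrDr; congr (_ * _).
  rewrite [in LHS](bigD1 j)//= eqxx [in RHS](bigD1 j)//= (eq_bigr t); first ring.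
  by move=> k /negPf; rewrite eq_sym => ->.
rewrite meanD mean_cst meanZ meanD.
rewrite (_ : mean (fun j => - t j) = - mean t); first ring.
by rewrite -mulN1r -meanZ; apply: eq_mean => k; rewrite mulN1r.
Qed.

(** Here [a], [b], [g] stand for one coordinate of the gradient errors at the iterate and at the
    memory points, and of the gradients at [xs]. The square of a sum of three terms costs the factor
    3, centring [b] only lowers its mean square, and [lam], [1 - lam] lie in [[0,1]]. *)
Lemma mean_sqr_saga (lam : R) (a b g : 'I_N -> R) : 0 <= lam <= 1 ->
  mean (fun k => (a k - lam * (b k - mean b) + (1 - lam) * g k) ^+ 2) <=
  3 * (mean (fun k => a k ^+ 2) + mean (fun k => b k ^+ 2)
       + mean (fun k => g k ^+ 2)).
Proof.
move=> /andP[l0 l1].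
have varb : mean (fun k => (b k - mean b) ^+ 2) <= mean (fun k => b k ^+ 2).
  rewrite (@eq_mean _ (fun k => b k ^+ 2 + ((- 2 * mean b) * b k + (mean b) ^+ 2))).
    by rewrite !meanD mean_cst meanZ; have := sqr_ge0 (mean b); lra.
  by move=> k; ring.
apply: (@le_trans _ _ (3 * (mean (fun k => a k ^+ 2)
    + mean (fun k => (b k - mean b) ^+ 2) + mean (fun k => g k ^+ 2)))); last first.
  by rewrite ler_pM2l// lerD2r lerD2l.
rewrite -!meanD -meanZ; apply: ler_mean => k.
set c := b k - mean b.
have cl : (lam * c) ^+ 2 <= c ^+ 2.
  by rewrite exprMn ler_piMl ?sqr_ge0// expr_le1.
have gl : ((1 - lam) * g k) ^+ 2 <= g k ^+ 2.
  by rewrite exprMn ler_piMl ?sqr_ge0// expr_le1//; lra.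
(* These three squares add up to three times the sum of the squares of the three terms minus the
   square of [a k - lam * c + (1 - lam) * g k]. *)
have := sqr_ge0 (a k + lam * c); have := sqr_ge0 (a k - (1 - lam) * g k).
have := sqr_ge0 (lam * c + (1 - lam) * g k).
move: cl gl; nra.
Qed.
End Mean.

(** * Measurability of gradients *)

Section VectorMeasurability.
Context {R : realType} {d : measure_display} {T : measurableType d}.

Definition vmeasurable {n : nat} (Y : T -> 'rV[R]_n) : Prop :=
  forall i, measurable_fun setT (fun w => Y w 0 i).

Lemma cvg_row {n : nat} (u : nat -> 'rV[R]_n) (x : 'rV[R]_n) :
  (forall i, (fun m => u m 0 i) @ \oo --> x 0 i) -> u @ \oo --> x.
Proof.
move=> ux; apply/cvgrPdist_lt => e e0.
have : \forall m \near \oo, forall i : 'I_n, `|x 0 i - u m 0 i| < e.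
  apply: filter_forall => i; move/cvgrPdist_lt : (ux i); exact.
apply: filterS => m xu.
rewrite [ltLHS]mx_normrE; apply: bigmax_lt => // -[i j] _.
by rewrite !mxE ord1; exact: xu.
Qed.

Lemma measurable_floor_eq (g : T -> R) (c : int) :
  measurable_fun setT g -> measurable [set w | Num.floor (g w) = c].
Proof.
move=> mg; rewrite (_ : [set w | _] = setT `&` g @^-1` `[c%:~R, (c + 1)%:~R[%classic).
  by apply: mg => //; exact: measurable_itv.
apply/seteqP; split => [w /= <-|w [_]] /=.
  by rewrite in_itv/= floor_le floorD1_gt.
by rewrite in_itv/= => h; apply/floor_def.
Qed.

(* The grid points [z / m.+1] take countably many values, so no topology on
   ['rV_n] has to be related to a sigma-algebra. *)
Definition grid {n : nat} (m : nat) (z : {ffun 'I_n -> int}) : 'rV[R]_n :=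
  \row_i ((z i)%:~R / m.+1%:R).

(** Rounding [Y] down to the grid of mesh [1/m.+1] gives functions with countably many values; their
    images under [h] are measurable and tend pointwise to [h \o Y] by continuity. *)
Lemma vmeasurable_continuous {n : nat} (h : 'rV[R]_n -> R) (Y : T -> 'rV[R]_n) :
  continuous h -> vmeasurable Y -> measurable_fun setT (h \o Y).
Proof.
move=> hc mY.
pose z m w : {ffun 'I_n -> int} := [ffun i => Num.floor (m.+1%:R * Y w 0 i)].
apply: (@measurable_fun_cvg _ _ _ _ (fun m w => h (grid m (z m w)))) => [m|w _].
  move=> _ B mB; rewrite setTI.
  rewrite (_ : _ @^-1` B = \bigcup_c
     if h (grid m c) \in B then \bigcap_(i in [set: 'I_n])
     [set w | Num.floor (m.+1%:R * Y w 0 i) = c i] else set0); last first.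
    apply/seteqP; split => [w /= Bw|w [c _]].
      by exists (z m w) => //; rewrite mem_set// => i _ /=; rewrite ffunE.
    case: ifPn => // /set_mem Bc cw /=.
    by rewrite (_ : z m w = c)//; apply/ffunP => i; rewrite ffunE cw.
  apply: countable_bigcupT_measurable => // c.
  case: ifPn => // _.
  apply: fin_bigcap_measurable => // i _.
  by apply: measurable_floor_eq; exact: measurable_funM.
apply: continuous_cvg; first exact: hc.
apply: cvg_row => i; apply/cvgrPdist_le => e e0; near=> m.
rewrite !mxE ffunE.
have m0 : 0 < m.+1%:R :> R by [].
have : m.+1%:R^-1 <= e.
  by apply: ltW; near: m; exact: (near_infty_natSinv_lt (PosNum e0)).
apply: le_trans; set c := Num.floor _.
have c1 : c%:~R <= m.+1%:R * Y w 0 i := floor_le _.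
have c2 : m.+1%:R * Y w 0 i < c%:~R + 1.
  by have := floorD1_gt (m.+1%:R * Y w 0 i); rewrite intrD.
rewrite ger0_norm; last by rewrite subr_ge0 ler_pdivrMr// mulrC.
rewrite lerBlDr.
rewrite [leRHS](_ : _ = (1 + c%:~R) / m.+1%:R); last by rewrite mulrDl mul1r.
by rewrite ler_pdivlMr// mulrC addrC ltW.
Unshelve. all: by end_near. Qed.

(** Since [F] is only differentiable, its gradient may be discontinuous; it is reached as the
    pointwise limit of difference quotients with increments [1/m.+1], which are measurable because
    [F] is continuous. *)
Lemma vmeasurable_grad {n : nat} (F : 'rV[R]_n -> R) (Y : T -> 'rV[R]_n) :
  (forall x, differentiable F x) -> vmeasurable Y ->
  vmeasurable (fun w => grad F (Y w)).
Proof.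
move=> dF mY i; pose v : 'rV[R]_n := delta_mx 0 i.
apply: (@measurable_fun_cvg _ _ _ _ (fun m w =>
    m.+1%:R * (F (m.+1%:R^-1 *: v + Y w) - F (Y w)))) => [m|w _].
  apply: measurable_funM => //; apply: measurable_funB; last first.
    apply: (@vmeasurable_continuous _ F Y) => // x.
    exact: differentiable_continuous.
  apply: (@vmeasurable_continuous _ F (fun w => m.+1%:R^-1 *: v + Y w)) => [x|j].
    exact: differentiable_continuous.
  rewrite (_ : (fun w => _) = (fun w => (m.+1%:R^-1 *: v) 0 j + Y w 0 j)).
    exact: measurable_funD.
  by apply/funext => w; rewrite mxE.
rewrite mxE; have dFw : derivable F (Y w) v by exact: diff_derivable.
rewrite (_ : (fun m => _) = (fun h => h^-1 *: ((F \o shift (Y w)) (h *: v) - F (Y w)))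
    \o (fun m => m.+1%:R^-1)); last by apply/funext => m /=; rewrite invrK.
apply: cvg_comp; last exact: dFw.
(* The derivative is a limit over punctured neighbourhoods of 0, and [1/m.+1] tends to 0 without
   vanishing. *)
move=> A A0.
have /(@cvg_harmonic R) : nbhs 0 [set y : R | y != 0 -> A y] by exact: A0.
rewrite /nbhs /=; apply: filterS => m /=; apply.
by rewrite gt_eqF// invr_gt0.
Qed.
End VectorMeasurability.

Section VectorMeasurabilityClosure.
Context {R : realType} {d : measure_display} {T : measurableType d} {n : nat}.
Implicit Types Y Z : T -> 'rV[R]_n.

Lemma vmeasurable_cst (y : 'rV[R]_n) : vmeasurable (fun _ : T => y).
Proof. by move=> i; exact: measurable_cst. Qed.

Lemma vmeasurableB Y Z :
  vmeasurable Y -> vmeasurable Z -> vmeasurable (fun w => Y w - Z w).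
Proof.
move=> mY mZ i.
rewrite (_ : (fun w => _) = (fun w => Y w 0 i - Z w 0 i)).
  exact: measurable_funB.
by apply/funext => w; rewrite !mxE.
Qed.

Lemma vmeasurableZ (c : R) Y : vmeasurable Y -> vmeasurable (fun w => c *: Y w).
Proof.
move=> mY i; rewrite (_ : (fun w => _) = (fun w => c * Y w 0 i)).
  exact: measurable_funM.
by apply/funext => w; rewrite !mxE.
Qed.

Lemma vmeasurable_sum (I : Type) (s : seq I) (F : I -> T -> 'rV[R]_n) :
  (forall k, vmeasurable (F k)) -> vmeasurable (fun w => \sum_(k <- s) F k w).
Proof.
move=> mF i; rewrite (_ : (fun w => _) = (fun w => \sum_(k <- s) F k w 0 i)).
  by apply: measurable_sum => k; exact: mF.
by apply/funext => w; rewrite summxE.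
Qed.

Lemma measurable_sqn Y : vmeasurable Y -> measurable_fun setT (fun w => sqn (Y w)).
Proof. by move=> mY; apply: measurable_sum => i; apply: measurable_funM; exact: mY. Qed.

Lemma measurable_mean {N : nat} (F : 'I_N -> T -> R) :
  (forall k, measurable_fun setT (F k)) ->
  measurable_fun setT (fun w => mean (fun k => F k w)).
Proof. by move=> mF; apply: measurable_funM => //; exact: measurable_sum. Qed.

Lemma measurable_fun_select {N : nat} {d'} {Y : measurableType d'} (F : 'I_N -> T -> Y)
    (V : T -> 'I_N) : (forall k, measurable (V @^-1` [set k])) ->
  (forall k, measurable_fun setT (F k)) -> measurable_fun setT (fun w => F (V w) w).
Proof.
move=> mV mF _ B mB; rewrite setTI.
rewrite (_ : _ @^-1` B =
    \bigcup_(k in [set: 'I_N]) (V @^-1` [set k] `&` F k @^-1` B)).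
  apply: fin_bigcup_measurable => // k _; apply: measurableI => //.
  by rewrite -[X in measurable X]setTI; exact: mF.
by apply/seteqP; split => [w /= Bw|w [k _ [/= <-]]//]; exists (V w).
Qed.

End VectorMeasurabilityClosure.

(** * Independence of the drawn index from the past *)

Section SubSigmaAlgebra.
Local Open Scope ereal_scope.
Context {R : realType} {d : measure_display} {T : measurableType d}.
Context {P : probability T R} {G : set (set T)}.
Hypothesis Gm : <<s G >> `<=` measurable.

Lemma measurable_fun_sub_sigma {d'} {Y : measurableType d'} (f : T -> Y) :
  measurable_fun (setT : set (g_sigma_algebraType G)) f ->
  measurable_fun (setT : set T) f.
Proof. by move=> mf _ B mB; apply: Gm; exact: mf. Qed.

(* [P] restricted to [D] agrees with [c P] on the sub-sigma-algebra, hence so do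
   their integrals of functions measurable for it. *)
Lemma ge0_integral_indep (D : set T) (c : {nonneg R}) (f : T -> \bar R) :
  measurable D ->
  (forall A, <<s G >> A -> P (A `&` D) = c%:num%:E * P A) ->
  measurable_fun (setT : set (g_sigma_algebraType G)) f -> (forall x, 0 <= f x) ->
  \int[P]_(x in D) f x = c%:num%:E * \int[P]_x f x.
Proof.
move=> mD PD mf f0.
have mfT := measurable_fun_sub_sigma _ mf.
(* The identity is seen as a map onto [T] with the smaller sigma-algebra: pushing a measure forward
   along it restricts that measure to [<<s G >>]. *)
have mid : measurable_fun (setT : set T) (idfun : T -> g_sigma_algebraType G).
  by move=> _ B mB; rewrite setTI; exact: Gm.
pose i : {mfun T >-> g_sigma_algebraType G} :=
  HB.pack (idfun : T -> g_sigma_algebraType G) (isMeasurableFun.Build _ _ _ _ _ mid).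
pose PrD : {measure set T -> \bar R} := mrestr P mD.
transitivity (\int[PrD]_(x in D) f x).
  by apply: eq_measure_integral => A mA AD; rewrite /PrD/= /mrestr setIidl.
transitivity (\int[PrD]_x f x).
  rewrite [RHS](@ge0_negligible_integral _ _ _ PrD setT (~` D)) ?setDE ?setCK ?setTI//.
    exact: measurableC.
  by rewrite /PrD/= /mrestr setICl measure0.
transitivity (\int[mscale c P]_x f x); last by rewrite ge0_integral_mscale.
transitivity (\int[pushforward PrD i]_x f x).
  by rewrite ge0_integral_pushforward.
transitivity (\int[pushforward (mscale c P) i]_x f x); last first.
  by rewrite ge0_integral_pushforward.
apply: eq_measure_integral => A mA _.
exact: (PD A mA).
Qed.
End SubSigmaAlgebra.

(** * Averaging over a uniform index independent of a sigma-algebra *)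

Section FreshIndex.
Local Open Scope ereal_scope.
Context {R : realType} {d : measure_display} {T : measurableType d}.
Context {P : probability T R} {G : set (set T)} {N : nat} {V : T -> 'I_N}.
Hypothesis Gm : <<s G >> `<=` measurable.
Hypothesis mV : forall k, measurable (V @^-1` [set k]).
Hypothesis GV : forall k A, <<s G >> A ->
  P (A `&` V @^-1` [set k]) = P A * (N%:R^-1)%:E.

(** The integral splits over the events [V = k]; on each, [g k] is measurable for [G], so
    independence contributes the factor [1/N]. *)
Lemma ge0_integral_average (g : 'I_N -> T -> R) :
  (forall k, measurable_fun (setT : set (g_sigma_algebraType G)) (g k)) ->
  (forall k x, (0 <= g k x)%R) ->
  \int[P]_w (g (V w) w)%:E = \int[P]_w (N%:R^-1 * \sum_(k < N) g k w)%:E.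
Proof.
move=> mg g0.
have Ni0 : (0 <= N%:R^-1 :> R)%R by rewrite invr_ge0.
have mgT k : measurable_fun (setT : set T) (EFin \o g k).
  by apply/measurable_EFinP; exact: (measurable_fun_sub_sigma Gm).
transitivity (\int[P]_w \sum_(k < N) ((EFin \o g k) \_ (V @^-1` [set k])) w).
  apply: eq_integral => w _; rewrite (bigD1 (V w))//= big1 ?adde0.
    by rewrite patchE mem_set.
  by move=> k kV; rewrite patchE memNset// => /esym/eqP; exact/negP.
rewrite ge0_integral_sum//; last 2 first.
- by move=> k; apply/(measurable_restrictT _ _).1 => //; exact: measurable_funTS.
- by move=> k w _; rewrite patchE; case: ifP => //= _; rewrite lee_fin.
under [RHS]eq_integral do rewrite EFinM -sumEFin.
rewrite ge0_integralZl//; last 2 first.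
- by apply: emeasurable_sum => k; exact: mgT.
- by move=> w _; apply: sume_ge0 => k _; rewrite lee_fin.
rewrite ge0_integral_sum//; last by move=> k w _; rewrite lee_fin.
rewrite ge0_sume_distrr; last first.
  by move=> k _; apply: integral_ge0 => w _; rewrite lee_fin.
apply: eq_bigr => k _; rewrite -integral_mkcond.
rewrite (@ge0_integral_indep _ _ _ _ _ Gm _ (NngNum Ni0))//.
- by move=> A hA; rewrite GV// muleC.
- exact/measurable_EFinP.
- by move=> w; rewrite lee_fin.
Qed.
End FreshIndex.

(** * The history sigma-algebra and the product rule on paths of indices *)

Section History.
Context {R : realType} {d : measure_display} {T : measurableType d}.
Context {P : probability T R} {N n : nat}.
Context {X0 X1 : T -> 'rV[R]_n} {U : nat -> T -> 'I_N}.

(** The past before [U m.+2] is drawn: the initial points and [U 2], ..., [U m.+1]. It determines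
    [X m.+1] and the memory [phi' X U m]. *)
Definition history_gen (m : nat) : set (set T) :=
  sigma_pair X0 X1 `|`
  [set E | exists (i : nat) (k : 'I_N), (i < m)%N /\ E = U i.+2 @^-1` [set k]].

(* A path prescribed for the first [m] indices, [U 2] being the first one drawn. *)
Definition cell (m : nat) (c : nat -> 'I_N) : set T :=
  [set w | forall i, (i < m)%N -> U i.+2 w = c i].

Hypothesis mX0 : vmeasurable X0.
Hypothesis mX1 : vmeasurable X1.
Hypothesis mU : forall i k, (2 <= i)%N -> measurable (U i @^-1` [set k]).
Hypothesis PU : forall i k, (2 <= i)%N -> P (U i @^-1` [set k]) = (N%:R^-1)%:E.
Hypothesis indep : mutually_independent P (saga_family X0 X1 U).

Lemma sigma_pair_sigma_algebra : sigma_algebra setT (sigma_pair X0 X1).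
Proof. exact: smallest_sigma_algebra. Qed.

Lemma sigma_pair_measurable : sigma_pair X0 X1 `<=` measurable.
Proof.
apply: smallest_sub; first exact: sigma_algebra_measurable.
move=> _ [i [b [B [mB ->]]]]; rewrite -[X in measurable X]setTI.
by case: b; [exact: (mX0 i)|exact: (mX1 i)].
Qed.

Lemma history_measurable m : <<s history_gen m >> `<=` measurable.
Proof.
apply: smallest_sub; first exact: sigma_algebra_measurable.
by move=> E [/sigma_pair_measurable//|[i [k [_ ->]]]]; exact: mU.
Qed.

Lemma measurable_cell m j c (S : set T) :
  <<s history_gen m >> S -> measurable (S `&` cell j c).
Proof.
move=> /history_measurable mS; apply: measurableI => //.
rewrite (_ : cell j c = \bigcap_(i in `I_j) U i.+2 @^-1` [set c i]) //.
by apply: bigcap_measurableType => i _; exact: mU.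
Qed.

(* On a cell every event of the history is an event of the initial points, which
   reduces independence from the past to the product rule on cells. *)
Lemma history_trace m c (S : set T) : <<s history_gen m >> S ->
  exists2 E, sigma_pair X0 X1 E & S `&` cell m c = E `&` cell m c.
Proof.
have [s0 sC sU] := sigma_pair_sigma_algebra.
have sT : sigma_pair X0 X1 setT by rewrite -(setD0 setT); exact: sC.
move: S; apply: smallest_sub; first split.
- by exists set0.
- move=> A [E sE AE]; exists (setT `\` E); first exact: sC.
  move/seteqP : AE => [AE EA].
  by apply/seteqP; split => w [[_ nA] cw]; split => //; split => // Ew;
    apply: nA; [apply: (EA w _).1|apply: (AE w _).1].
- move=> A hA.
  have /choice[E sE] i : exists E,
      sigma_pair X0 X1 E /\ A i `&` cell m c = E `&` cell m c.
    by have [E] := hA i; exists E.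
  exists (\bigcup_i E i).
    by apply: sU => i; have [] := sE i.
  rewrite !setI_bigcupl; apply: eq_bigcupr => i _; by have [] := sE i.
- move=> A [sA|[i [k [im ->]]]]; first by exists A.
  have [cik|cik] := eqVneq (c i) k.
    exists setT => //; apply/seteqP; split => w [_ cw]; split => //=.
    by rewrite cw.
  exists set0 => //; apply/seteqP; split => w [] //= Uk cw.
  by move: cik; rewrite -Uk cw ?eqxx.
Qed.

(** Numbered as in [saga_family], with its trivial slot 1, so that mutual independence applies
    directly. *)
Definition cell_event (E : set T) (c : nat -> 'I_N) (i : nat) : set T :=
  match i with 0 => E | 1 => setT | j.+2 => U j.+2 @^-1` [set c j] end.

(** Mutual independence factorises both sides, over the slots up to [m.+2] and up to [m.+1]; the
    only extra factor is the uniform weight of [U m.+2]. *)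
Lemma prob_cellS m c E : sigma_pair X0 X1 E ->
  P (E `&` cell m.+1 c) = (P (E `&` cell m c) * (N%:R^-1)%:E)%E.
Proof.
move=> sE; pose J k := [fset i in iota 0 k.+2]%fset.
have inJ k i : (i \in J k) = (i < k.+2)%N by rewrite in_fset mem_iota.
have cellE k : E `&` cell k c = \bigcap_(i in [set` J k]) cell_event E c i.
  apply/seteqP; split => [w [Ew cw] [|[|i]] //=|w Jw].
    by rewrite inJ !ltnS => /cw.
  split; first by apply: (Jw 0%N); rewrite /= inJ.
  by move=> i ik; apply: (Jw i.+2); rewrite /= inJ !ltnS.
have evJ k i : i \in J k -> saga_family X0 X1 U i (cell_event E c i).
  case: i => [|[|i]] //= _; first by right.
  by exists [set c i].
have JS : J m.+1 = (m.+2 |` J m)%fset.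
  by apply/fsetP => i; rewrite in_fset1U !inJ ltnS leq_eqVlt.
rewrite !cellE !indep; [|exact: evJ..].
rewrite JS big_fsetU1 /=; last by rewrite inJ ltnn.
by rewrite PU// muleC.
Qed.

Lemma prob_split i (A : set T) : (2 <= i)%N -> measurable A ->
  P A = (\sum_(l < N) P (A `&` U i @^-1` [set l]))%E.
Proof.
move=> i2 mA; pose F (l : 'I_N) := A `&` U i @^-1` [set l].
have tF : trivIset setT F.
  by apply/trivIsetP => l l' _ _ /eqP ll'; apply/seteqP; split => // w [[_ Ul] [_ Ul']];
    apply: ll'; rewrite -Ul -Ul'.
have mF l : measurable (F l) by apply: measurableI => //; exact: mU.
rewrite -(@measure_bigsetU_ord _ _ _ P N xpredT F mF tF); congr (P _).
apply/seteqP; split => [w Aw|]; first by rewrite (bigD1 (U i w))//=; left.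
by elim/big_ind: _ => // [B C AB AC w [/AB|/AC]|l _ w []].
Qed.

(** Descending induction on [j]. For [j = m] the trace of [S] is that of an event of the initial
    points and [prob_cellS] applies; for [j < m] the cell is cut along the values of [U j.+2] into
    cells of length [j.+1]. *)
Lemma prob_history_cell m j c (S : set T) k : <<s history_gen m >> S -> (j <= m)%N ->
  P (S `&` cell j c `&` U m.+2 @^-1` [set k]) =
  (P (S `&` cell j c) * (N%:R^-1)%:E)%E.
Proof.
move=> hS; elim: {j}(m - j)%N {-2}j (erefl (m - j)%N) c => [|q IH] j jq c jm.
  have {jm} -> : j = m by apply/eqP; rewrite eqn_leq jm -subn_eq0 jq.
  (* The path is prolonged by [k] at place [m], so that adding the event [U m.+2 = k] to [cell m c']
     yields [cell m.+1 c']. *)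
  pose c' i := if (i < m)%N then c i else k.
  have cc' : cell m c = cell m c'.
    by apply/seteqP; split => w cw i im; have := cw _ im; rewrite /c' im.
  have [E sE SE] := @history_trace m c' S hS.
  rewrite cc' SE -prob_cellS// -setIA; congr (P (_ `&` _)).
  apply/seteqP; split => [w [cw Uk] i|w cw].
    rewrite ltnS leq_eqVlt => /orP[/eqP->|]; last exact: cw.
    by rewrite /c' ltnn.
  split; first by move=> i im; apply: cw; rewrite ltnS ltnW.
  by rewrite /= cw// /c' ltnn.
have jm' : (j < m)%N by rewrite -subn_gt0 jq.
rewrite (@prob_split j.+2 (S `&` cell j c))//; last exact: (@measurable_cell m).
rewrite (@prob_split j.+2 (S `&` cell j c `&` _))//; last first.
  by apply: measurableI; [exact: (@measurable_cell m)|exact: mU].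
rewrite ge0_sume_distrl//; apply: eq_bigr => l _.
pose c' i := if i == j then l else c i.
have cE : S `&` cell j c `&` U j.+2 @^-1` [set l] = S `&` cell j.+1 c'.
  rewrite -setIA; congr (_ `&` _); apply/seteqP; split => [w [cw Ul] i|w cw].
    rewrite ltnS leq_eqVlt => /orP[/eqP->|ij]; first by rewrite /c' eqxx.
    by rewrite /c' ltn_eqF//; exact: cw.
  split; last by rewrite /= cw// /c' eqxx.
  by move=> i ij; have := cw i (ltnW ij); rewrite /c' ltn_eqF.
rewrite setIAC cE; apply: IH => //.
by rewrite subnS jq.
Qed.

Lemma prob_history m (S : set T) k : <<s history_gen m >> S ->
  P (S `&` U m.+2 @^-1` [set k]) = (P S * (N%:R^-1)%:E)%E.
Proof.
move=> hS; have := @prob_history_cell m 0 (fun=> k) S k hS isT.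
by rewrite (_ : cell 0 _ = setT) ?setIT// -subTset => w _ i.
Qed.

End History.

(** * Expectations of nonnegative functions and series *)

Section Expectation.
Local Open Scope ereal_scope.
Context {R : realType} {d : measure_display} {T : measurableType d}.
Context {P : probability T R}.
Implicit Types f g : T -> R.

(** Nonnegative coefficients keep linearity valid in the extended reals, where it is applied before
    the expectations are known to be finite. *)
Lemma ge0_expect_affine f g (a b c : R) :
  measurable_fun setT f -> measurable_fun setT g ->
  (forall w, 0 <= f w)%R -> (forall w, 0 <= g w)%R ->
  (0 <= a)%R -> (0 <= b)%R -> (0 <= c)%R ->
  \int[P]_w (a * f w + b * g w + c)%:E =
  a%:E * (\int[P]_w (f w)%:E) + b%:E * (\int[P]_w (g w)%:E) + c%:E.
Proof.
move=> mf mg f0 g0 a0 b0 c0.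
have mEf : measurable_fun setT (EFin \o f) by exact/measurable_EFinP.
have mEg : measurable_fun setT (EFin \o g) by exact/measurable_EFinP.
transitivity (\int[P]_w ((a%:E * (f w)%:E + b%:E * (g w)%:E) + cst c%:E w)).
  by apply: eq_integral => w _ /=; rewrite !EFinD !EFinM.
rewrite ge0_integralD//; last 2 first.
- by move=> w _; rewrite adde_ge0// mule_ge0// lee_fin.
- by apply: emeasurable_funD; apply: measurable_funeM.
rewrite ge0_integralD//; last 4 first.
- by move=> w _; rewrite mule_ge0// lee_fin.
- exact: measurable_funeM.
- by move=> w _; rewrite mule_ge0// lee_fin.
- exact: measurable_funeM.
rewrite !ge0_integralZl_EFin//; try by move=> w _; rewrite lee_fin.
by rewrite integral_cst//= probability_setT mule1.
Qed.

Lemma le_expect f g : measurable_fun setT f -> measurable_fun setT g ->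
  (forall w, 0 <= f w)%R -> (forall w, f w <= g w)%R ->
  \int[P]_w (f w)%:E <= \int[P]_w (g w)%:E.
Proof.
move=> mf mg f0 fg; apply: ge0_le_integral => //.
- by move=> w _; rewrite lee_fin.
- exact/measurable_EFinP.
- exact/measurable_EFinP.
- by move=> w _; rewrite lee_fin.
Qed.

(** By Tonelli the sum has a finite integral, and an integrable function is finite almost
    everywhere. *)
Lemma ae_nneseries_lty (h : nat -> T -> R) :
  (forall n, (1 <= n)%N -> measurable_fun setT (h n)) ->
  (forall n w, (1 <= n)%N -> (0 <= h n w)%R) ->
  \sum_(1 <= n <oo) \int[P]_w (h n w)%:E < +oo ->
  {ae P, forall w, \sum_(1 <= n <oo) (h n w)%:E < +oo}.
Proof.
move=> mh h0 hoo.
(* The value 0 at index 0 allows passing from sums starting at 1 to sums over all indices. *)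
pose f n w := if (1 <= n)%N then (h n w)%:E else 0.
have mf n : measurable_fun setT (f n).
  by case: n => [|n]; [exact: measurable_cst|apply/measurable_EFinP; exact: mh].
have f0 n w : 0 <= f n w by rewrite /f; case: ifP => // n1; rewrite lee_fin h0.
have sumE (u : nat -> \bar R) :
    \sum_(1 <= n <oo) u n = \sum_(n <oo) if (1 <= n)%N then u n else 0.
  by rewrite eseries_cond eseries_mkcond.
have intf : P.-integrable setT (fun w => \sum_(n <oo) f n w).
  apply/integrableP; split; first by apply: (ge0_emeasurable_sum (P := xpredT)).
  rewrite (eq_integral (fun w => \sum_(n <oo) f n w)); last first.
    by move=> w _; rewrite gee0_abs// nneseries_ge0.
  rewrite integral_nneseries//.
  rewrite sumE in hoo; apply: le_lt_trans hoo; apply: lee_nneseries => [n _ _|n _].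
    exact: integral_ge0.
  by case: n => [|n] //=; rewrite integral0.
apply: filterS (integrable_ae _ intf) => // w /(_ I).
by rewrite sumE fin_numElt => /andP[].
Qed.

End Expectation.

(** * The averaged step *)

Section Vectors.
Context {R : realType} {d : nat}.
Implicit Types u v w : 'rV[R]_d.

Lemma sqnE u : sqn u = \sum_(i < d) u 0 i ^+ 2.
Proof. by apply: eq_bigr => i _; rewrite expr2. Qed.

Lemma sqn_ge0 u : 0 <= sqn u.
Proof. by rewrite sqnE sumr_ge0// => i _; exact: sqr_ge0. Qed.

Lemma dotv_sumr (I : Type) (s : seq I) u (F : I -> 'rV[R]_d) :
  dotv u (\sum_(k <- s) F k) = \sum_(k <- s) dotv u (F k).
Proof.
rewrite /dotv exchange_big; apply: eq_bigr => i _.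
by rewrite summxE mulr_sumr.
Qed.

Lemma dotvZr u (c : R) v : dotv u (c *: v) = c * dotv u v.
Proof. by rewrite /dotv mulr_sumr; apply: eq_bigr => i _; rewrite mxE; ring. Qed.

Lemma sqnB_scale u (c : R) v :
  sqn (u - c *: v) = sqn u + (- (2 * c)) * dotv u v + c ^+ 2 * sqn v.
Proof.
rewrite !sqnE /dotv !mulr_sumr -!big_split; apply: eq_bigr => i _ /=.
by rewrite !mxE; ring.
Qed.

Lemma sqnB_le u v : sqn (u - v) <= 2 * sqn u + 2 * sqn v.
Proof.
rewrite !sqnE !mulr_sumr -big_split; apply: ler_sum => i _ /=.
by rewrite !mxE; have := sqr_ge0 (u 0 i + v 0 i); nra.
Qed.

End Vectors.

Section SagaStep.
Context {R : realType} {N d : nat} {fk : 'I_N -> 'rV[R]_d -> R}.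
Context {lam : R} {xs : 'rV[R]_d}.
Implicit Types (x : 'rV[R]_d) (p : 'I_N -> 'rV[R]_d).

Definition saga_dir x p (k : 'I_N) : 'rV[R]_d :=
  grad (fk k) x
  - lam *: (grad (fk k) (p k) - N%:R^-1 *: \sum_(j < N) grad (fk j) (p j)).

Definition mem_error p : R :=
  mean (fun k => sqn (grad (fk k) (p k) - grad (fk k) xs)).

(* The gradients of the [fk k] at [xs] only vanish on average: for [lam < 1] they
   leave a variance that does not decay with the error. *)
Definition noise : R := mean (fun k => sqn (grad (fk k) xs)).

Hypothesis N0 : (0 < N)%N.
Hypothesis dfk : forall k x, differentiable (fk k) x.

Lemma grad_favg x : grad (favg fk) x = N%:R^-1 *: \sum_k grad (fk k) x.
Proof.
apply/rowP => i; rewrite !mxE summxE.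
have df k : derivable (fk k) x (delta_mx 0 i : 'rV[R]_d) by exact: diff_derivable.
rewrite (_ : favg fk = N%:R^-1 \*: (\sum_(k < N) fk k)).
  rewrite deriveZ; last exact: derivable_sum.
  rewrite derive_sum//; congr (_ *: _); apply: eq_bigr => k _; by rewrite mxE.
by apply/funext => y; rewrite /favg /= fct_sumE.
Qed.

Hypothesis lam01 : 0 <= lam <= 1.
Hypothesis gxs : grad (favg fk) xs = 0.

(** The memory correction has mean zero over the index, so the direction is an unbiased estimate of
    the full gradient. *)
Lemma mean_saga_dir x p : N%:R^-1 *: \sum_k saga_dir x p k = grad (favg fk) x.
Proof.
rewrite grad_favg /saga_dir big_split /= sumrN -scaler_sumr big_split /= sumrN.
rewrite sumr_const card_ord -[(_ *: _) *+ N]scaler_nat scalerA.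
rewrite mulfV; last by rewrite pnatr_eq0 -lt0n.
by rewrite scale1r subrr scaler0 subr0.
Qed.

(** Coordinate by coordinate this is [mean_sqr_saga], once all gradients are compared with their
    values at [xs]. *)
Lemma mean_sqn_saga_dir x p :
  mean (fun k => sqn (saga_dir x p k)) <=
  3 * (tau2 fk xs x + mem_error p + noise).
Proof.
rewrite /tau2 -/(mean _) /mem_error /noise.
pose D k y i := (grad (fk k) y - grad (fk k) xs) 0 i.
have sumE (F : 'I_N -> 'rV[R]_d) :
    mean (fun k => sqn (F k)) = \sum_(i < d) mean (fun k => F k 0 i ^+ 2).
  by rewrite -mean_sum; apply: eq_mean => k; rewrite sqnE.
rewrite !sumE -!big_split mulr_sumr; apply: ler_sum => i _ /=.
have gxs_i : mean (fun k => grad (fk k) xs 0 i) = 0.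
  have /rowP/(_ i) := gxs; rewrite grad_favg !mxE summxE => <-.
  by congr (_ * _); apply: eq_bigr => k _.
have := @mean_sqr_saga R N N0 lam (fun k => D k x i) (fun k => D k (p k) i)
  (fun k => grad (fk k) xs 0 i) lam01.
rewrite (@eq_mean _ _ _ (fun k => (saga_dir x p k) 0 i ^+ 2))// => k; congr (_ ^+ 2).
(* The gradients at [xs] have mean 0, so the memory errors and the memory gradients have the same
   mean. *)
have -> : mean (fun j => D j (p j) i) = mean (fun j => grad (fk j) (p j) 0 i).
  rewrite (@eq_mean _ _ _ (fun j => grad (fk j) (p j) 0 i + (-1) * grad (fk j) xs 0 i)).
    by rewrite meanD meanZ gxs_i mulr0 addr0.
  by move=> j; rewrite /D !mxE mulN1r.
rewrite /D /saga_dir /mean.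
rewrite [RHS]mxE [X in _ = _ + X]mxE [X in _ = _ - X]mxE [X in _ = _ - _ * X]mxE.
rewrite [X in _ = _ - _ * (_ + X)]mxE [X in _ = _ - _ * (_ - X)]mxE summxE.
rewrite !mxE; ring.
Qed.

Context {L mu : R}.
Hypothesis tauL : forall x, tau2 fk xs x <= L * sqn (x - xs).
Hypothesis convex : forall x, mu * sqn (x - xs) <= dotv (x - xs) (grad (favg fk) x).

(** In the expanded square the cross term averages to the full gradient, where the lower bound by
    [mu] enters, and the quadratic term is bounded by [mean_sqn_saga_dir]. The [mu] term stays on
    the left so that no subtraction appears when the inequality is integrated. *)
Lemma mean_sqn_saga_step x p (c : R) : 0 <= c ->
  mean (fun k => sqn (x - c *: saga_dir x p k - xs)) + 2 * c * (mu * sqn (x - xs))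
  <= sqn (x - xs) + 3 * c ^+ 2 * (L * sqn (x - xs) + mem_error p + noise).
Proof.
move=> c0.
rewrite (@eq_mean _ _ _ (fun k => sqn (x - xs) + (- (2 * c)) * dotv (x - xs) (saga_dir x p k)
   + c ^+ 2 * sqn (saga_dir x p k))); last first.
  by move=> k; rewrite -sqnB_scale addrAC.
rewrite !meanD mean_cst// !meanZ.
have -> : mean (fun k => dotv (x - xs) (saga_dir x p k)) =
    dotv (x - xs) (grad (favg fk) x).
  by rewrite -(mean_saga_dir x p) dotvZr dotv_sumr.
have h1 : c * (mu * sqn (x - xs)) <= c * dotv (x - xs) (grad (favg fk) x).
  by rewrite ler_wpM2l.
have h2 : c ^+ 2 * mean (fun k => sqn (saga_dir x p k)) <=
    c ^+ 2 * (3 * (L * sqn (x - xs) + mem_error p + noise)).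
  rewrite ler_wpM2l ?sqr_ge0//; apply: le_trans (mean_sqn_saga_dir _ _) _.
  by rewrite ler_pM2l// !lerD2r.
lra.
Qed.

End SagaStep.

(** * The Lyapunov argument *)

Section NonnegSeries.
Context {R : realType}.
Implicit Types u : nat -> R.

Definition bounded_sums u : Prop := exists M, forall m, \sum_(1 <= n < m) u n <= M.

Lemma bounded_sumsP u : (forall n, (1 <= n)%N -> 0 <= u n) ->
  bounded_sums u <-> (\sum_(1 <= n <oo) (u n)%:E < +oo)%E.
Proof.
move=> u0; split=> [[M uM]|].
  apply: (@le_lt_trans _ _ M%:E); last exact: ltry.
  apply: lime_le; first by apply: is_cvg_nneseries_cond => n n1 _; rewrite lee_fin u0.
  by apply: nearW => m; rewrite sumEFin lee_fin.
set s := (X in (X < _)%E) => soo.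
have s0 : (0 <= s)%E by apply: nneseries_ge0 => n n1 _; rewrite lee_fin u0.
exists (fine s) => m; rewrite -lee_fin fineK ?ge0_fin_numE// -sumEFin.
by apply: nneseries_lim_ge => n n1 _; rewrite lee_fin u0.
Qed.

Lemma bounded_sums_le (c : R) u v : 0 <= c ->
  (forall n, (1 <= n)%N -> u n <= c * v n) -> bounded_sums v -> bounded_sums u.
Proof.
move=> c0 uv [M vM]; exists (c * M) => m.
apply: (@le_trans _ _ (c * \sum_(1 <= n < m) v n)); last exact: ler_wpM2l.
rewrite mulr_sumr big_nat_cond [leRHS]big_nat_cond.
by apply: ler_sum => n /andP[/andP[n1 _] _]; exact: uv.
Qed.

Context {gam v a : nat -> R} {b L mu C : R}.
Hypothesis gam_gt0 : forall n, (1 <= n)%N -> 0 < gam n.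
Hypothesis gam_dec : forall n, (1 <= n)%N -> gam n.+1 <= gam n.
Hypothesis gam_cvg : gam @ \oo --> 0.
Hypothesis gam_sqr : bounded_sums (fun n => gam n ^+ 2).
Hypothesis v0 : forall n, (1 <= n)%N -> 0 <= v n.
Hypothesis a0 : forall n, (1 <= n)%N -> 0 <= a n.
Hypothesis b_gt0 : 0 < b.
Hypothesis L0 : 0 < L.
Hypothesis mu0 : 0 < mu.
Hypothesis C0 : 0 <= C.
Hypothesis vS : forall n, (1 <= n)%N ->
  v n.+1 + 2 * gam n * (mu * v n) <= v n + 3 * gam n ^+ 2 * (L * v n + a n + C).
Hypothesis aS : forall n, (1 <= n)%N ->
  a n.+1 <= (1 - b) * a n + b * (L * v n).

(* The weight [mu / (b L)] makes the part [gam n * mu * v n] of the decrease of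
   [v] pay for the growth of [a], and leaves a decrease proportional to
   [gam n * (L * v n + a n)]. *)
Let W n := v n + mu / (b * L) * gam n * a n.

Lemma lyapunov_step n : (1 <= n)%N ->
  W n.+1 + mu / L * gam n * (L * v n + a n) <=
  W n + 3 * gam n ^+ 2 * (L * v n + a n + C).
Proof.
move=> n1; rewrite /W; set c := mu / (b * L).
have c0 : 0 < c by rewrite divr_gt0// mulr_gt0.
have Lc : mu / L = c * b by rewrite /c; field; rewrite !gt_eqF.
have muc : mu = c * b * L by rewrite /c; field; rewrite !gt_eqF.
have g0 := gam_gt0 _ n1.
(* The monotonicity of the steps lets the weight of [a n.+1] in [W n.+1] be frozen at [gam n]. *)
have h1 : c * gam n.+1 * a n.+1 <= c * gam n * a n.+1.
  by rewrite ler_wpM2r ?a0// ler_pM2l// gam_dec.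
have h2 : c * gam n * a n.+1 <= c * gam n * ((1 - b) * a n + b * (L * v n)).
  by apply: ler_wpM2l (aS _ n1); rewrite ltW// mulr_gt0.
have := vS _ n1; rewrite {1}muc Lc => h3; lra.
Qed.

(** Once [3 * gam n <= K], with [K] half of the rate [mu / L], half of the decrease in
    [lyapunov_step] absorbs the quadratic term in [v] and [a]. The other half is summed by
    telescoping, against the finite sum of the squared steps. *)
Lemma lyapunov_bounded_sums : bounded_sums (fun n => gam n * (L * v n + a n)).
Proof.
have [Q gQ] := gam_sqr.
pose K := mu / (2 * L); have K0 : 0 < K by rewrite divr_gt0// mulr_gt0.
have [n0 n01 gK] : exists2 n0, (1 <= n0)%N & forall n, (n0 <= n)%N -> 3 * gam n <= K.
  have K3 : 0 < K / 3 by rewrite divr_gt0.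
  have /cvgrPdist_le /(_ _ K3) [n0 _ gn0] := gam_cvg.
  exists n0.+1 => // n n0n; have := gn0 n (ltnW n0n).
  rewrite sub0r normrN => /(le_trans (ler_norm _)); lra.
pose s n := gam n * (L * v n + a n).
have s0 n : (1 <= n)%N -> 0 <= s n.
  move=> n1; rewrite mulr_ge0 ?(ltW (gam_gt0 _ n1))// addr_ge0 ?a0//.
  by rewrite mulr_ge0 ?v0// ltW.
pose S m := \sum_(1 <= n < m) s n.
pose Qs m := \sum_(1 <= n < m) gam n ^+ 2.
have W0 n : (1 <= n)%N -> 0 <= W n.
  move=> n1; rewrite addr_ge0 ?v0// !mulr_ge0 ?a0 ?(ltW (gam_gt0 _ n1))//.
    exact: ltW.
  by rewrite invr_ge0 mulr_ge0// ltW.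
have descent k : W (n0 + k)%N + K * S (n0 + k)%N - 3 * C * Qs (n0 + k)%N <=
    W n0 + K * S n0 - 3 * C * Qs n0.
  elim: k => [|k]; first by rewrite addn0.
  apply: le_trans; rewrite addnS; set n := (n0 + k)%N.
  have n1 : (1 <= n)%N by rewrite (leq_trans n01)// leq_addr.
  rewrite /S /Qs !big_nat_recr//= -/(S n) -/(Qs n).
  have := lyapunov_step _ n1.
  have -> : mu / L * gam n * (L * v n + a n) = 2 * K * s n.
    by rewrite /K /s; field; rewrite gt_eqF.
  have -> : 3 * gam n ^+ 2 * (L * v n + a n + C) =
      3 * gam n * s n + 3 * C * gam n ^+ 2 by rewrite /s; ring.
  have : 3 * gam n * s n <= K * s n by rewrite ler_wpM2r ?s0// gK// leq_addr.
  lra.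
exists (K^-1 * (W n0 + K * S n0 - 3 * C * Qs n0 + 3 * C * Q)) => m.
(* Partial sums of [s] increase, so a bound at [n0 + m], within the range of [descent], also covers
   [m]. *)
have Sm : S m <= S (n0 + m)%N.
  have [m1|m1] := leqP 1 m; last first.
    rewrite [leLHS]big_geq ?(ltnW m1)// [leRHS]big_nat_cond sumr_ge0// => n.
    by move=> /andP[/andP[n1 _] _]; exact: s0.
  rewrite /S [leRHS](@big_cat_nat _ _ _ m)//=; last exact: leq_addl.
  rewrite lerDl big_nat_cond sumr_ge0// => n /andP[/andP[mn _] _].
  by apply: s0; exact: leq_trans mn.
apply: (le_trans Sm).
rewrite -(ler_pM2l K0) mulrA mulfV ?mul1r; last by rewrite gt_eqF.
have := descent m; have := W0 (n0 + m)%N.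
rewrite (leq_trans n01) ?leq_addr// => /(_ isT) w0.
have : 3 * C * Qs (n0 + m)%N <= 3 * C * Q by rewrite ler_wpM2l ?mulr_ge0// gQ.
lra.
Qed.

End NonnegSeries.

(** * The stochastic recursion *)

Section SagaTrajectory.
Context {R : realType} {dT : measure_display} {T : measurableType dT}.
Context {P : probability T R} {N d : nat} {fk : 'I_N -> 'rV[R]_d -> R}.
Context {lam : R} {gam : nat -> R} {xs : 'rV[R]_d} {L mu : R}.
Context {X : nat -> T -> 'rV[R]_d} {U : nat -> T -> 'I_N}.
Hypothesis N0 : (0 < N)%N.
Hypothesis dfk : forall k x, differentiable (fk k) x.
Hypothesis recX : saga_recursion fk lam gam X U.

Let H m := g_sigma_algebraType (history_gen (X0 := X 0%N) (X1 := X 1%N) (U := U) m).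

Lemma vmeasurable_saga_dir {d'} {S : measurableType d'} (x : S -> 'rV[R]_d)
    (p : 'I_N -> S -> 'rV[R]_d) j : vmeasurable x -> (forall k, vmeasurable (p k)) ->
  vmeasurable (fun w => saga_dir (fk := fk) (lam := lam) (x w) (p^~ w) j).
Proof.
move=> mx mp; apply: vmeasurableB; first exact: vmeasurable_grad.
apply: vmeasurableZ; apply: vmeasurableB; first exact: vmeasurable_grad.
apply: vmeasurableZ; apply: vmeasurable_sum => k; exact: vmeasurable_grad.
Qed.

(** The recursion at [n = m.+1], where [phi X U m.+1] unfolds to [phi' X U m]. *)
Lemma saga_stepE m w : X m.+2 w =
  X m.+1 w - gam m.+1 *: saga_dir (fk := fk) (lam := lam) (X m.+1 w)
    (fun k => phi' X U m k w) (U m.+2 w).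
Proof. exact: recX. Qed.

Lemma history_mono m {d'} {Y : measurableType d'} (f : T -> Y) :
  measurable_fun (setT : set (H m)) f -> measurable_fun (setT : set (H m.+1)) f.
Proof.
move=> mf _ B mB; have := mf measurableT B mB.
apply: sub_sigma_algebra2 => A [sA|[i [k [im ->]]]]; first by left.
by right; exists i, k; split => //; rewrite ltnW.
Qed.

(** Induction on [m]: the new iterate and the new memory are picked by [U m.+2] from finitely many
    functions measurable for the past, and [U m.+2] itself belongs to the next history. *)
Lemma saga_history_measurable m :
  vmeasurable (X m.+1 : H m -> _) /\ (forall k, vmeasurable (phi' X U m k : H m -> _)).
Proof.
elim: m => [|m [mX mp]].
  (* In the base case the iterate is [X 1] and every memory point is [X 0], both measurable for
     [sigma_pair]. *)
  have h (b : bool) (Z := if b then X 0%N else X 1%N) : vmeasurable (Z : H 0 -> _).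
    move=> i _ B mB; rewrite setTI; apply: sub_sigma_algebra; left.
    apply: sub_sigma_algebra; exists i, b, B; split => //.
    by apply/seteqP; split => w; rewrite /= /Z; case: b Z.
  by split => [|k]; [exact: (h false)|exact: (h true)].
have mU k : measurable (U m.+2 @^-1` [set k] : set (H m.+1)).
  by apply: sub_sigma_algebra; right; exists m, k.
have mX' : vmeasurable (X m.+1 : H m.+1 -> _) by move=> i; apply: history_mono; exact: mX.
have mp' k : vmeasurable (phi' X U m k : H m.+1 -> _).
  by move=> i; apply: history_mono; exact: mp.
have mS j : vmeasurable (fun w : H m.+1 => X m.+1 w - gam m.+1 *:
    saga_dir (fk := fk) (lam := lam) (X m.+1 w) ((phi' X U m)^~ w) j).
  apply: vmeasurableB => //; apply: vmeasurableZ.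
  exact: (@vmeasurable_saga_dir _ (H m.+1)).
split => [|k] i.
  pose F j (w : H m.+1) := (X m.+1 w - gam m.+1 *:
    saga_dir (fk := fk) (lam := lam) (X m.+1 w) ((phi' X U m)^~ w) j) 0 i.
  rewrite (_ : (fun w => X m.+2 w 0 i) = (fun w => F (U m.+2 w) w)).
    exact: measurable_fun_select (fun j => mS j i).
  by apply/funext => w; rewrite saga_stepE.
pose F j (w : H m.+1) := if j == k then X m.+1 w 0 i else phi' X U m k w 0 i.
rewrite (_ : (fun w => phi' X U m.+1 k w 0 i) = (fun w => F (U m.+2 w) w)).
  apply: measurable_fun_select mU _ => j; rewrite /F.
  by case: (j == k); [exact: mX'|exact: mp'].
by apply/funext => w; rewrite /F /=; case: (U m.+2 w == k).
Qed.

Hypothesis mX0 : vmeasurable (X 0%N).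
Hypothesis mX1 : vmeasurable (X 1%N).
Hypothesis mU : forall i k, (2 <= i)%N -> measurable (U i @^-1` [set k]).
Hypothesis PU : forall i k, (2 <= i)%N -> P (U i @^-1` [set k]) = (N%:R^-1)%:E.
Hypothesis indep : mutually_independent P (saga_family (X 0%N) (X 1%N) U).

Let Hm m := history_measurable (n := d) mX0 mX1 mU m.

Lemma saga_measurable n : vmeasurable (X n).
Proof.
case: n => [//|m] i.
exact: (measurable_fun_sub_sigma (Hm m) _ ((saga_history_measurable m).1 i)).
Qed.

Lemma memory_measurable n k : vmeasurable (phi' X U n k).
Proof.
move=> i; exact: (measurable_fun_sub_sigma (Hm n) _ ((saga_history_measurable n).2 k i)).
Qed.

Lemma measurable_sqn_error n : measurable_fun setT (fun w => sqn (X n w - xs)).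
Proof.
apply: measurable_sqn; apply: vmeasurableB; first exact: saga_measurable.
exact: vmeasurable_cst.
Qed.

Lemma measurable_tau2 n : measurable_fun setT (fun w => tau2 fk xs (X n w)).
Proof.
apply: measurable_mean => k; apply: measurable_sqn; apply: vmeasurableB.
  by apply: vmeasurable_grad => //; exact: saga_measurable.
exact: vmeasurable_cst.
Qed.

Lemma measurable_Aseq n : measurable_fun setT (Aseq fk xs X U n).
Proof.
apply: measurable_mean => k; apply: measurable_sqn; apply: vmeasurableB.
  by apply: vmeasurable_grad => //; exact: memory_measurable.
exact: vmeasurable_cst.
Qed.

Lemma tau2_ge0 x : 0 <= tau2 fk xs x.
Proof. by apply: mean_ge0 => k; exact: sqn_ge0. Qed.

Lemma Aseq_ge0 n w : 0 <= Aseq fk xs X U n w.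
Proof. by apply: mean_ge0 => k; exact: sqn_ge0. Qed.

(** Stands for conditioning on the past: [g k] is determined before [U m.+2] is drawn, so that index
    can be averaged out. *)
Lemma expect_average m (g : 'I_N -> T -> R) :
  (forall k, measurable_fun (setT : set (H m)) (g k)) ->
  (forall k w, 0 <= g k w) ->
  (\int[P]_w (g (U m.+2 w) w)%:E = \int[P]_w (mean (g^~ w))%:E)%E.
Proof.
apply: ge0_integral_average; [exact: Hm|by move=> k; exact: mU|].
by move=> k A; exact: (prob_history mX0 mX1 mU PU indep).
Qed.

Hypothesis lam01 : 0 <= lam <= 1.
Hypothesis gam0 : forall n, (1 <= n)%N -> 0 < gam n.
Hypothesis gxs : grad (favg fk) xs = 0.
Hypothesis L0 : 0 < L.
Hypothesis tauL : forall x, tau2 fk xs x <= L * sqn (x - xs).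
Hypothesis mu0 : 0 < mu.
Hypothesis convex : forall x, mu * sqn (x - xs) <= dotv (x - xs) (grad (favg fk) x).

Let EV n := (\int[P]_w (sqn (X n w - xs))%:E)%E.
Let EA n := (\int[P]_w (Aseq fk xs X U n w)%:E)%E.
Let C := noise (fk := fk) (xs := xs).

(** Integrates [mean_sqn_saga_step], in extended reals because the finiteness of the expectations is
    itself deduced from this bound. *)
Lemma expect_V_step n : (1 <= n)%N ->
  (EV n.+1 + (2 * gam n * mu)%:E * EV n <=
   (1 + 3 * gam n ^+ 2 * L)%:E * EV n + (3 * gam n ^+ 2)%:E * EA n
   + (3 * gam n ^+ 2 * C)%:E)%E.
Proof.
case: n => // m _; have g0 := gam0 m.+1 isT; set c := gam m.+1 in g0 *.
have [mX mp] := saga_history_measurable m.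
pose g k w := sqn (X m.+1 w - c *:
  saga_dir (fk := fk) (lam := lam) (X m.+1 w) ((phi' X U m)^~ w) k - xs).
have mg k : measurable_fun (setT : set (H m)) (g k).
  apply: measurable_sqn; apply: vmeasurableB; last exact: vmeasurable_cst.
  apply: vmeasurableB => //; apply: vmeasurableZ.
  exact: (@vmeasurable_saga_dir _ (H m)).
have EVS : EV m.+2 = (\int[P]_w (mean (g^~ w))%:E)%E.
  rewrite -(expect_average _ _ mg); last by move=> k w; exact: sqn_ge0.
  by apply: eq_integral => w _; rewrite saga_stepE.
have mmg : measurable_fun setT (fun w => mean (g^~ w)).
  by apply: measurable_mean => k; exact: (measurable_fun_sub_sigma (Hm m)).
have C0 : 0 <= C by apply: mean_ge0 => k; exact: sqn_ge0.
have c2 : 0 <= 3 * c ^+ 2 by rewrite mulr_ge0// sqr_ge0.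
(* Coefficient 1 and constant 0 give the left side the form required by [ge0_expect_affine]. *)
rewrite -(mul1e (EV m.+2)) -[leLHS]adde0 EVS /EV /EA.
have V0 w : 0 <= sqn (X m.+1 w - xs) := sqn_ge0 _.
have A0 := Aseq_ge0 m.+1.
have mV := measurable_sqn_error m.+1; have mA := measurable_Aseq m.+1.
have mg0 w : 0 <= mean (g^~ w) by apply: mean_ge0 => k; exact: sqn_ge0.
have cmu : 0 <= 2 * c * mu by rewrite !mulr_ge0// ltW.
have cL : 0 <= 1 + 3 * c ^+ 2 * L by rewrite addr_ge0// mulr_ge0// ltW.
have cC : 0 <= 3 * c ^+ 2 * C by rewrite mulr_ge0.
rewrite -(@ge0_expect_affine _ _ _ P _ _ 1 (2 * c * mu) 0)//.
rewrite -ge0_expect_affine//.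
apply: le_expect => [||w|w].
- apply: measurable_funD => //; apply: measurable_funD; exact: measurable_funM.
- apply: measurable_funD => //; apply: measurable_funD; exact: measurable_funM.
- by rewrite addr0 mul1r; apply: addr_ge0 => //; exact: mulr_ge0.
have : mean (g^~ w) + 2 * c * (mu * sqn (X m.+1 w - xs)) <=
    sqn (X m.+1 w - xs)
    + 3 * c ^+ 2 * (L * sqn (X m.+1 w - xs) + Aseq fk xs X U m.+1 w + C).
  exact: (mean_sqn_saga_step N0 dfk lam01 gxs tauL convex _ _ _ (ltW g0)).
move: (mean _) (sqn _) (Aseq _ _ _ _ _ _) => M V A; lra.
Qed.

(** The drawn slot receives [X n] and the others are kept, so [mean_refresh] applies; the mean of
    the fresh errors is [tau2], at most [L] times the squared distance. *)
Lemma expect_A_step n : (1 <= n)%N ->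
  (EA n.+1 <= (1 - N%:R^-1)%:E * EA n + (N%:R^-1 * L)%:E * EV n)%E.
Proof.
case: n => // m _.
have [mX mp] := saga_history_measurable m.
pose e k (x : 'rV[R]_d) := sqn (grad (fk k) x - grad (fk k) xs).
have me k (Y : H m -> 'rV[R]_d) : vmeasurable Y -> measurable_fun setT (fun w => e k (Y w)).
  move=> mY; apply: measurable_sqn; apply: vmeasurableB; last exact: vmeasurable_cst.
  exact: vmeasurable_grad.
pose g j w := mean (fun k => if j == k then e k (X m.+1 w) else e k (phi' X U m k w)).
have mg j : measurable_fun (setT : set (H m)) (g j).
  by apply: measurable_mean => k; case: (j == k); exact: me.
have EAS : EA m.+2 = (\int[P]_w (mean (g^~ w))%:E)%E.
  rewrite -(expect_average _ _ mg); last first.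
    by move=> k w; apply: mean_ge0 => j; case: ifP => _; exact: sqn_ge0.
  apply: eq_integral => w _; congr EFin; apply: eq_mean => k.
  by rewrite /phi /=; case: ifP.
have b0 : 0 <= N%:R^-1 :> R by rewrite invr_ge0.
have b1 : 0 <= 1 - N%:R^-1 :> R by rewrite subr_ge0 invf_le1 ?ltr0n ?ler1n.
have bL : 0 <= N%:R^-1 * L by rewrite mulr_ge0// ltW.
rewrite EAS -[leRHS]adde0.
rewrite -(@ge0_expect_affine _ _ _ P (Aseq fk xs X U m.+1) _ _ _ 0)//; last 4 first.
- exact: measurable_Aseq.
- exact: measurable_sqn_error.
- exact: Aseq_ge0.
- by move=> w; exact: sqn_ge0.
apply: le_expect => [||w|w].
- by apply: measurable_mean => k; exact: (measurable_fun_sub_sigma (Hm m)).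
- apply: measurable_funD => //; apply: measurable_funD; apply: measurable_funM => //.
    exact: measurable_Aseq.
  exact: measurable_sqn_error.
- by do 2 (apply: mean_ge0 => ?); case: ifP => _; exact: sqn_ge0.
rewrite (@mean_refresh _ _ N0 (fun k => e k (X m.+1 w)) (fun k => e k (phi' X U m k w))).
rewrite addr0 lerD2l -mulrA ler_wpM2l//; exact: tauL.
Qed.

Hypothesis iX0 : P.-integrable setT (fun w => (sqn (X 0%N w))%:E).
Hypothesis iX1 : P.-integrable setT (fun w => (sqn (X 1%N w))%:E).

Lemma expect_error_lty n : P.-integrable setT (fun w => (sqn (X n w))%:E) ->
  (EV n < +oo)%E.
Proof.
move=> iX; have V0 := @sqn_ge0 R d.
have mX : measurable_fun setT (fun w => sqn (X n w)).
  by apply: measurable_sqn; exact: saga_measurable.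
have := @ge0_expect_affine _ _ _ P _ _ 2 0 (2 * sqn xs) mX mX
  (fun w => V0 _) (fun w => V0 _) (ler0n R 2) (lexx 0).
rewrite mulr_ge0// => /(_ isT) EX.
apply: (@le_lt_trans _ _ (\int[P]_w (2 * sqn (X n w) + 0 * sqn (X n w) + 2 * sqn xs)%:E)%E).
  apply: le_expect => [||w|w]; first exact: measurable_sqn_error.
  - by apply: measurable_funD => //; apply: measurable_funD; exact: measurable_funM.
  - exact: V0.
  - by rewrite mul0r addr0 sqnB_le.
rewrite EX mul0e adde0 lte_add_pinfty ?ltry// lte_mul_pinfty//.
exact: (integrable_lty _ iX).
Qed.

Lemma expect_tau2_le n :
  (\int[P]_w (tau2 fk xs (X n w))%:E <= L%:E * EV n)%E.
Proof.
rewrite -ge0_integralZl_EFin//; last 3 first.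
- by move=> w _; rewrite lee_fin sqn_ge0.
- by apply/measurable_EFinP; exact: measurable_sqn_error.
- exact: ltW.
under [leRHS]eq_integral do rewrite -EFinM.
apply: le_expect => [||w|w].
- exact: measurable_tau2.
- by apply: measurable_funM => //; exact: measurable_sqn_error.
- exact: tau2_ge0.
- exact: tauL.
Qed.

(** Induction along the two expected steps, started from the square integrability of [X 0] and
    [X 1]: two base cases, since the recursion starts at [n = 1]. *)
Lemma expect_fin n : EV n \is a fin_num /\ EA n \is a fin_num.
Proof.
have EV0 k : (0 <= EV k)%E by apply: integral_ge0 => w _; rewrite lee_fin sqn_ge0.
have EA0 k : (0 <= EA k)%E by apply: integral_ge0 => w _; rewrite lee_fin Aseq_ge0.
have V0 : (EV 0 < +oo)%E by exact: expect_error_lty.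
(* At index 1 all memory points equal [X 0], so [EA 1] is the expectation of [tau2] at [X 0]. *)
have A1 : (EA 1 < +oo)%E.
  by apply: le_lt_trans (expect_tau2_le 0%N) _; rewrite lte_mul_pinfty// lee_fin ltW.
(* Indices 0 and 1 share the same memory, as [phi] uses [n.-1]. *)
have A0 : (EA 0 < +oo)%E by rewrite (_ : EA 0 = EA 1)//; exact: eq_integral.
rewrite (ge0_fin_numE (EV0 n)) (ge0_fin_numE (EA0 n)).
elim: n => [|[|n] [Vn An]]; first by split; [exact: V0|exact: A0].
  by split; [exact: expect_error_lty|exact: A1].
have g2 : 0 <= 3 * gam n.+1 ^+ 2 by rewrite mulr_ge0// sqr_ge0.
have EVA : (EV n.+2 + (2 * gam n.+1 * mu)%:E * EV n.+1 < +oo)%E.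
  apply: le_lt_trans (expect_V_step n.+1 isT) _.
  apply: lte_add_pinfty; last exact: ltry.
  apply: lte_add_pinfty; apply: lte_mul_pinfty => //.
  by rewrite lee_fin addr_ge0// mulr_ge0// ltW.
split.
  apply: le_lt_trans EVA; apply: leeDl; apply: mule_ge0 => //; rewrite lee_fin.
  by rewrite mulr_ge0 ?(ltW mu0)// mulr_ge0// ltW// gam0.
apply: le_lt_trans (expect_A_step n.+1 isT) _.
apply: lte_add_pinfty; apply: lte_mul_pinfty => //; rewrite lee_fin.
  by rewrite subr_ge0 invf_le1 ?ltr0n ?ler1n.
by rewrite mulr_ge0 ?invr_ge0// ltW.
Qed.

Hypothesis gam_dec : forall n, (1 <= n)%N -> gam n.+1 <= gam n.
Hypothesis gam_cvg : gam @ \oo --> 0.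
Hypothesis gam_sqr : (\sum_(1 <= n <oo) ((gam n) ^+ 2)%:E < +oo)%E.

Lemma saga_bounded_sums :
  bounded_sums (fun n => gam n * (L * fine (EV n) + fine (EA n))).
Proof.
have EVE n : EV n = (fine (EV n))%:E by rewrite fineK// (expect_fin n).1.
have EAE n : EA n = (fine (EA n))%:E by rewrite fineK// (expect_fin n).2.
(* The memory contracts at rate [b = 1/N], and the constant [C] is the residual [noise]. *)
apply: (@lyapunov_bounded_sums R gam _ _ (N%:R^-1) L mu C) => //.
- by apply/bounded_sumsP => // n _; exact: sqr_ge0.
- by move=> n _; apply/fine_ge0/integral_ge0 => w _; rewrite lee_fin sqn_ge0.
- by move=> n _; apply/fine_ge0/integral_ge0 => w _; rewrite lee_fin Aseq_ge0.
- by rewrite invr_gt0 ltr0n.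
- by apply: mean_ge0 => k; exact: sqn_ge0.
- move=> n n1; have := expect_V_step n n1.
  rewrite (EVE n.+1) (EVE n) (EAE n) -!EFinM -!EFinD lee_fin; lra.
- move=> n n1; have := expect_A_step n n1.
  by rewrite (EAE n.+1) (EVE n) (EAE n) -!EFinM -!EFinD lee_fin mulrA.
Qed.

Lemma saga_expect_series :
  [/\ (\sum_(1 <= n <oo) ((gam n)%:E * EV n) < +oo)%E,
   (\sum_(1 <= n <oo) ((gam n)%:E * EA n) < +oo)%E &
   (\sum_(1 <= n <oo) ((gam n)%:E * \int[P]_w (tau2 fk xs (X n w))%:E) < +oo)%E].
Proof.
have V0 n : 0 <= fine (EV n).
  by apply/fine_ge0/integral_ge0 => w _; rewrite lee_fin sqn_ge0.
have A0 n : 0 <= fine (EA n).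
  by apply/fine_ge0/integral_ge0 => w _; rewrite lee_fin Aseq_ge0.
have tau0 n : (0 <= \int[P]_w (tau2 fk xs (X n w))%:E)%E.
  by apply: integral_ge0 => w _; rewrite lee_fin tau2_ge0.
have EVE n : EV n = (fine (EV n))%:E by rewrite fineK// (expect_fin n).1.
have EAE n : EA n = (fine (EA n))%:E by rewrite fineK// (expect_fin n).2.
have tauE n : (\int[P]_w (tau2 fk xs (X n w))%:E)%E =
    (fine (\int[P]_w (tau2 fk xs (X n w))%:E)%E)%:E.
  rewrite fineK// ge0_fin_numE//; apply: le_lt_trans (expect_tau2_le n) _.
  by rewrite EVE -EFinM ltry.
have tauV n : fine (\int[P]_w (tau2 fk xs (X n w))%:E)%E <= L * fine (EV n).
  by have := expect_tau2_le n; rewrite tauE EVE -EFinM lee_fin.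
(* All three series are compared with the one of [saga_bounded_sums]: the constant is [1/L] for
   [EV], 1 for [EA], and 1 for [tau2] by [expect_tau2_le]. *)
have dominated (u : nat -> \bar R) (c : R) : (forall n, u n = (fine (u n))%:E) ->
    (forall n, 0 <= fine (u n)) -> 0 <= c ->
    (forall n, fine (u n) <= c * (L * fine (EV n) + fine (EA n))) ->
    (\sum_(1 <= n <oo) ((gam n)%:E * u n) < +oo)%E.
  move=> uE u0 c0 uc.
  under eq_eseriesr do rewrite uE -EFinM.
  apply/bounded_sumsP => [n n1|]; first by rewrite mulr_ge0// ltW// gam0.
  apply: bounded_sums_le c0 _ saga_bounded_sums => n n1.
  by rewrite mulrCA; apply: ler_wpM2l; rewrite ?uc// ltW// gam0.
split.
- apply: (dominated EV L^-1 EVE V0); first by rewrite invr_ge0 ltW.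
  move=> n; rewrite mulrDr mulKf ?gt_eqF// lerDl.
  by apply: mulr_ge0; [rewrite invr_ge0 ltW|exact: A0].
- apply: (dominated EA 1 EAE A0 ler01) => n; rewrite mul1r lerDr.
  by apply: mulr_ge0; [exact: ltW|exact: V0].
- apply: (dominated _ 1 tauE _ ler01) => n; first exact: fine_ge0 (tau0 n).
  by rewrite mul1r; apply: (le_trans (tauV n)); rewrite lerDl; exact: A0.
Qed.

(** The deterministic factor [gam n] is moved inside the integral, which turns the hypothesis into
    that of [ae_nneseries_lty]. *)
Lemma ae_gam_series (h : nat -> T -> R) : (forall n, measurable_fun setT (h n)) ->
  (forall n w, 0 <= h n w) ->
  (\sum_(1 <= n <oo) ((gam n)%:E * \int[P]_w (h n w)%:E) < +oo)%E ->
  {ae P, forall w, \sum_(1 <= n <oo) (gam n * h n w)%:E < +oo}%E.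
Proof.
move=> mh h0 hoo.
apply: (ae_nneseries_lty (fun n w => gam n * h n w)) => [n n1|n w n1|].
- exact: measurable_funM.
- by rewrite mulr_ge0// ltW// gam0.
rewrite (_ : (\sum_(1 <= n <oo) _)%E =
    (\sum_(1 <= n <oo) ((gam n)%:E * \int[P]_w (h n w)%:E))%E)//.
apply: congr_lim; apply/funext => m; apply: eq_big_nat => n /andP[n1 _].
under eq_integral do rewrite EFinM.
rewrite ge0_integralZl_EFin//.
- by move=> w _; rewrite lee_fin.
- exact/measurable_EFinP.
- by rewrite ltW// gam0.
Qed.

End SagaTrajectory.

Theorem theorem5 (R : realType) (dT : measure_display) (T : measurableType dT)
  (P : probability T R) (N d : nat) (fk : 'I_N -> 'rV[R]_d -> R)
  (lam : R) (gam : nat -> R) (xs : 'rV[R]_d) (L mu : R)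
  (X : nat -> T -> 'rV[R]_d) (U : nat -> T -> 'I_N) :
  (0 < N)%N ->
  (* each f_k differentiable *)
  (forall k x, differentiable (fk k) x) ->
  (* lambda in [0,1] *)
  0 <= lam <= 1 ->
  (* step sizes: positive, nonincreasing, to 0, sum = oo, sum of squares < oo *)
  (forall n, (1 <= n)%N -> 0 < gam n) ->
  (forall n, (1 <= n)%N -> gam n.+1 <= gam n) ->
  gam @ \oo --> 0 ->
  (\sum_(1 <= n <oo) (gam n)%:E = +oo)%E ->
  (\sum_(1 <= n <oo) ((gam n) ^+ 2)%:E < +oo)%E ->
  (* X_0, X_1: square-integrable random vectors *)
  (forall i, measurable_fun setT (fun w => X 0%N w 0 i)) ->
  (forall i, measurable_fun setT (fun w => X 1%N w 0 i)) ->
  P.-integrable setT (fun w => (sqn (X 0%N w))%:E) ->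
  P.-integrable setT (fun w => (sqn (X 1%N w))%:E) ->
  (* (U_n)_{n>=2} i.i.d. uniform on {1..N}, independent of (X_0,X_1) *)
  (forall n k, (2 <= n)%N -> measurable (U n @^-1` [set k])) ->
  (forall n k, (2 <= n)%N -> P (U n @^-1` [set k]) = (N%:R^-1)%:E) ->
  mutually_independent P (saga_family (X 0%N) (X 1%N) U) ->
  (* the lambda-SAGA recursion *)
  saga_recursion fk lam gam X U ->
  (* (A1) f continuously differentiable, unique zero xs of grad f *)
  (forall x, differentiable (favg fk) x) ->
  continuous (grad (favg fk)) ->
  grad (favg fk) xs = 0 ->
  (forall x, grad (favg fk) x = 0 -> x = xs) ->
  (* (A3) *)
  0 < L ->
  (forall x, tau2 fk xs x <= L * sqn (x - xs)) ->
  (* (A5) *)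
  0 < mu ->
  (forall x, mu * sqn (x - xs) <= dotv (x - xs) (grad (favg fk) x)) ->
  (* conclusions *)
  ({ae P, forall w, \sum_(1 <= n <oo) (gam n * sqn (X n w - xs))%:E < +oo}%E
   /\ {ae P, forall w, \sum_(1 <= n <oo) (gam n * Aseq fk xs X U n w)%:E < +oo}%E
   /\ {ae P, forall w, \sum_(1 <= n <oo) (gam n * tau2 fk xs (X n w))%:E < +oo}%E)
  /\
  ((\sum_(1 <= n <oo) ((gam n)%:E * \int[P]_w (sqn (X n w - xs))%:E) < +oo)%E
   /\ (\sum_(1 <= n <oo) ((gam n)%:E * \int[P]_w (Aseq fk xs X U n w)%:E) < +oo)%E
   /\ (\sum_(1 <= n <oo) ((gam n)%:E * \int[P]_w (tau2 fk xs (X n w))%:E) < +oo)%E).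
Proof.
move=> N0 dfk lam01 gam0 gam_dec gam_cvg _ gam_sqr mX0 mX1 iX0 iX1 mU PU indep recX.
move=> _ _ gxs _ L0 tauL mu0 convex.
have [sV sA sT] := saga_expect_series N0 dfk recX mX0 mX1 mU PU indep lam01 gam0
  gxs L0 tauL mu0 convex iX0 iX1 gam_dec gam_cvg gam_sqr.
split; last by split; [exact: sV|split; [exact: sA|exact: sT]].
split; [|split].
- apply: (ae_gam_series gam0 (fun n w => sqn (X n w - xs))) sV => n.
    exact: (measurable_sqn_error dfk recX mX0 mX1 mU).
  by move=> w; exact: sqn_ge0.
- apply: (ae_gam_series gam0 (Aseq fk xs X U)) sA => n.
    exact: (measurable_Aseq dfk recX mX0 mX1 mU).
  by move=> w; exact: Aseq_ge0.
- apply: (ae_gam_series gam0 (fun n w => tau2 fk xs (X n w))) sT => n.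
    exact: (measurable_tau2 dfk recX mX0 mX1 mU).
  by move=> w; exact: tau2_ge0.
Qed.
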